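(* For each cardinal $\kappa\ge\omega$ and each natural number $n\ge1$ there is a $\mathcal C(\kappa)$-space $Y$ which is the disjoint union of $n$ dense submaximal subspaces. Such a $Y$, automatically, does not contain any (nonempty) $(n+1)$-resolvable subspaces.
   Context: For a space $X$, $\Delta(X)$ is the minimum cardinality of a nonempty open subset of $X$, and $\operatorname{nwd}(X)$ is the minimum cardinality of a somewhere dense (i.e. not nowhere dense) subset of $X$. $X$ is NODEC if all nowhere dense subsets of $X$ are closed (hence closed discrete). $D(2)$ is the discrete two-point space. For an infinite cardinal $\kappa$, a $\mathcal C(\kappa)$-space is a dense NODEC subspace $X$ of the Cantor cube $D(2)^{2^\kappa}$ with $|X|=\operatorname{nwd}(X)=\Delta(X)=\kappa$. A space is submaximal if all of its dense subsets are open. A space is $m$-resolvable if it contains $m$ many pairwise disjoint dense subsets. *)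

(* Defs.v *)
From mathcomp Require Import all_boot all_order.
From mathcomp Require Import all_classical topology.

Set Implicit Arguments.
Unset Strict Implicit.
Unset Printing Implicit Defensive.

Local Open Scope classical_set_scope.
Local Open Scope card_scope.

(** Conventions.
    - Cardinals are represented by types: a type [K] stands for the cardinal
      [#|K|], equality and comparison of cardinals being [#=] and [#<=].
    - All notions are properties of a topological space [T]. A subspace
      [A : set T] is the space [set_type A], to which [A] coerces, and which
      the library equips with the initial topology of its inclusion. *)

Definition nowhere_dense (T : topologicalType) (A : set T) : Prop :=
  interior (closure A) = set0.

(** [K] is the minimum of the cardinalities of the members of [F]; the minimum
    is required to be attained. *)
Definition min_card (T : Type) (F : set (set T)) (K : Type) : Prop :=
  (exists2 A, F A & A #= [set: K]) /\ (forall A, F A -> [set: K] #<= A).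

(** [Delta(T) = #|K|] *)
Definition Delta_is (T : topologicalType) (K : Type) : Prop :=
  min_card [set U : set T | open U /\ U !=set0] K.

(** [nwd(T) = #|K|] *)
Definition nwd_is (T : topologicalType) (K : Type) : Prop :=
  min_card [set A : set T | ~ nowhere_dense A] K.

Definition nodec (T : topologicalType) : Prop :=
  forall A : set T, nowhere_dense A -> closed A.

Definition submaximal (T : topologicalType) : Prop :=
  forall D : set T, dense D -> open D.

(** [#|M|]-resolvability. *)
Definition resolvable (M : Type) (T : topologicalType) : Prop :=
  exists D : M -> set T, (forall i, dense (D i)) /\ trivIset [set: M] D.

(** The Cantor cube [D(2)^(2^#|K|)]: the index set is the power set of [K], and
    the topology of [bool] in the library is discrete. *)
Definition cantor_cube (K : Type) : topologicalType :=
  prod_topology (fun _ : set K => bool).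

(** [X] is a [C(#|K|)]-space. *)
Definition C_space (K : Type) (X : set (cantor_cube K)) : Prop :=
  [/\ dense X, nodec X, [set: X] #= [set: K], nwd_is X K & Delta_is X K].

Definition disjoint_union_dense_submaximal (n : nat) (T : topologicalType) :
    Prop :=
  exists D : 'I_n -> set T,
    [/\ trivIset [set: 'I_n] D, \bigcup_i D i = [set: T],
        forall i, dense (D i) & forall i, submaximal (D i)].

(* Main.v *)
Require Import Defs.
From mathcomp Require Import all_boot all_order.
From mathcomp Require Import all_classical topology.

(** Existence rests on a maximal ideal. Start from a set [S] of size [#|K|]
    with a dense copy in the Cantor cube, i.e. an independent family of subsets
    of [S] indexed by [set K], so rich that every trace of a basic open set has
    size [#|K|] ([independent_family]). The subsets of size less than [#|K|]
    form an ideal disjoint from these traces; by Zorn's lemma extend it to an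
    ideal [J] which is maximal among those containing no trace
    ([maximal_ideal]). Maximality says that every [N] outside [J] contains a
    trace up to a member of [J].

    Now change the independent family on members of [J] only. The traces move
    by members of [J], so none of them enters [J]. There are no more pairs
    (member of [J], point outside it) than coordinates, hence room to reserve a
    coordinate for each such pair and to let it separate the point from the
    set: all members of [J] become closed. A set [N] outside [J] then contains
    a trace minus a closed set, a nonempty open set. So a set belongs to [J]
    iff it has empty interior, complements of dense sets are closed, and the
    space is submaximal.

    For [n] pieces, the same is done on [S * 'I_n]: all [n] copies of [S] use
    the same independent family and a set is small when each of its [n] slices
    is in [J] ([exists_submaximal_coloring]). Each copy is dense and
    submaximal, a nowhere dense set of the union has all slices in [J] and is
    closed, and nonempty open sets and somewhere dense sets have a slice
    outside [J], so that they have size [#|K|]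
    ([submaximal_coloring_space]).

    Non-resolvability is a pigeonhole argument. In a submaximal dense piece
    [D], any [E] included in [D] either contains the trace on [D] of a nonempty
    open set, or misses a nonempty open set ([submaximal_dichotomy]). If [n.+1]
    disjoint sets are dense in an open set, then after shrinking it [n.+1] times
    each of them contains the whole trace of one of the [n] pieces; two of them
    use the same piece and meet. A nowhere dense subspace is discrete, and not
    resolvable for that reason. *)

Set Implicit Arguments.
Unset Strict Implicit.
Unset Printing Implicit Defensive.

Local Open Scope classical_set_scope.
Local Open Scope card_scope.

(** * Zorn's lemma and infinite cardinal arithmetic *)

Lemma Zorn_above (T : Type) (P : set (set T)) (A0 : set T) :
    P A0 ->
    (forall F : set (set T), F `<=` P -> F !=set0 -> total_on F subset ->
      P (\bigcup_(X in F) X)) ->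
  exists A, [/\ P A, A0 `<=` A & forall B, A `<=` B -> P B -> B `<=` A].
Proof.
move=> PA0 Pchain.
have [F FP Ftot|A [PA Amax]] := @Zorn_bigcup T [set A | P (A0 `|` A)].
  have [->|/set0P[X0 FX0]] := eqVneq F set0.
    by rewrite /= bigcup_set0 setU0.
  rewrite /=; have -> : A0 `|` \bigcup_(X in F) X =
      \bigcup_(Y in [set A0 `|` X | X in F]) Y.
    apply/seteqP; split=> [t [At|[X FX Xt]]|t [_ [X FX <-]] [At|Xt]].
    - by exists (A0 `|` X0); [exists X0|left].
    - by exists (A0 `|` X); [exists X|right].
    - by left.
    - by right; exists X.
  apply: Pchain.
  - by move=> _ [X FX <-]; exact: FP.
  - by exists (A0 `|` X0), X0.
  - move=> _ _ [X FX <-] [Y FY <-].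
    by have [XY|YX] := Ftot _ _ FX FY; [left|right]; apply: setUS.
exists (A0 `|` A); split=> // B AB PB; apply: contrapT => nBA.
apply: (Amax B); last by rewrite /= setUidr// => x Ax; apply: AB; left.
split; first by move=> x Ax; apply: AB; right.
by move=> BA; apply: nBA => x Bx; right; exact: BA.
Qed.

(** Lets an injection be given by a relation, so that no default value is needed
    in a target type that may be empty. *)
Lemma card_le_graph (T U : Type) (A : set T) (B : set U) (H : T -> U -> Prop) :
    (forall x, A x -> exists2 y, B y & H x y) ->
    (forall x x' y, A x -> A x' -> H x y -> H x' y -> x = x') ->
  A #<= B.
Proof.
move=> HAB Hinj.
have /choice[f fH] (x : A) : exists y : B, H (val x) (val y).
  by have [y By Hy] := HAB _ (set_valP x); exists (SigSub (mem_set By)).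
apply/card_leP/injfunPex; exists f => //= x x' _ _ ff'; apply/val_inj.
apply: (Hinj _ _ (val (f x))) => //; try exact: set_valP.
by rewrite ff'.
Qed.

Lemma card_le_fun (T U : Type) (A : set T) (B : set U) (u0 : U) :
    A #<= B ->
  exists2 f : T -> U, (forall x, A x -> B (f x)) & set_inj A f.
Proof.
by elim/Ppointed: U => U in B u0 *; [case: (no u0)|
  move=> /pcard_leP/injfunPex].
Qed.

Lemma card_leTP (T U : Type) (A : set U) :
  [set: T] #<= A <-> exists2 f : T -> U, injective f & forall x, A (f x).
Proof.
split=> [|[f finj fA]]; last first.
  by apply: (@card_le_graph _ _ _ _ (fun x y => f x = y)) => [x _|x x' _ _ _ <-];
    [exists (f x)|move/finj].
have [/set0P[u0 _]|/negPn/eqP U0] := boolP ([set: U] != set0).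
  move=> /(card_le_fun u0)[f fA finj]; exists f => [x y|x]; last exact: fA.
  by apply: finj; rewrite inE.
have -> : A = set0 by rewrite -subset0 -U0.
move=> /card_le0P T0.
have no (x : T) : False by have : [set: T] x := I; rewrite T0.
by exists (fun x => match no x with end) => x; case: (no x).
Qed.

(** A maximal partial injection from [A] to [B] exhausts [A] or [B]. *)
Lemma card_le_total (T U : Type) (A : set T) (B : set U) :
  A #<= B \/ B #<= A.
Proof.
pose P (H : set (T * U)) :=
  [/\ forall x y, H (x, y) -> A x /\ B y,
      forall x y y', H (x, y) -> H (x, y') -> y = y' &
      forall x x' y, H (x, y) -> H (x', y) -> x = x'].
have [F FP Ftot|H [[HAB Hf Hi] Hmax]] := @Zorn_bigcup _ P.
  have common p q X Y : F X -> F Y -> X p -> Y q -> exists2 Z, F Z & Z p /\ Z q.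
    by move=> FX FY Xp Yq; have [XY|YX] := Ftot _ _ FX FY;
      [exists Y; last by split=> //; exact: XY
      |exists X; last by split=> //; exact: YX].
  split=> [x y [X /FP[XAB _ _] /XAB//]| |].
    move=> x y y' [X FX Xp] [Y FY Yq].
    by have [Z /FP[_ Zf _] [Zp]] := common _ _ _ _ FX FY Xp Yq; exact: Zf.
  move=> x y y' [X FX Xp] [Y FY Yq].
  by have [Z /FP[_ _ Zi] [Zp]] := common _ _ _ _ FX FY Xp Yq; exact: Zi.
have [dom|] := pselect (forall x, A x -> exists2 y, B y & H (x, y)).
  by left; apply: (card_le_graph dom) => x x' y _ _; exact: Hi.
move=> /existsNP[a /not_implyP[Aa na]].
have [ran|] := pselect (forall y, B y -> exists2 x, A x & H (x, y)).
  right; apply: (@card_le_graph _ _ _ _ (fun y x => H (x, y)) ran).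
  by move=> y y' x _ _; exact: Hf.
move=> /existsNP[b /not_implyP[Bb nb]]; exfalso.
apply: (Hmax ((a, b) |` H)); first split.
- by move=> p; right.
- move=> /(_ (a, b)) Hab; apply: na; exists b => //.
  by apply: Hab; left.
- have Ha y : ~ H (a, y) by move=> Hy; apply: na; exists y => //; case: (HAB _ _ Hy).
  have Hb x : ~ H (x, b) by move=> Hx; apply: nb; exists x => //; case: (HAB _ _ Hx).
  split.
  + by move=> x y [[-> ->]//|/HAB].
  + move=> x y y' [[-> ->]|Hxy] [[]|]; try by [].
    * by move=> /Ha.
    * by move=> e; move: Hxy; rewrite e => /Ha.
    * exact: Hf Hxy.
  + move=> x x' y [[-> ->]|Hxy] [[]|]; try by [].
    * by move=> /Hb.
    * by move=> _ e; move: Hxy; rewrite e => /Hb.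
    * exact: Hi Hxy.
Qed.

Definition sq_dom (K : Type) (G : set (K * K * K)) : set K :=
  [set x | exists z, G (x, x, z)].

(** [G] is the graph of an injection of [A * A] into [A], where [A] is
    [sq_dom G]. With graphs, Zorn's lemma applies to inclusion. *)
Definition sq_embedding (K : Type) (G : set (K * K * K)) : Prop :=
  [/\ forall x y z, G (x, y, z) -> [/\ sq_dom G x, sq_dom G y & sq_dom G z],
      forall x y, sq_dom G x -> sq_dom G y -> exists z, G (x, y, z),
      forall x y z z', G (x, y, z) -> G (x, y, z') -> z = z' &
      forall x y x' y' z, G (x, y, z) -> G (x', y', z) -> (x, y) = (x', y')].

Lemma sq_embedding_bigcup (K : Type) (F : set (set (K * K * K))) :
    F `<=` @sq_embedding K -> total_on F subset ->
  sq_embedding (\bigcup_(X in F) X).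
Proof.
move=> FP Ftot.
have common p q X Y : F X -> F Y -> X p -> Y q -> exists2 Z, F Z & Z p /\ Z q.
  by move=> FX FY Xp Yq; have [XY|YX] := Ftot _ _ FX FY;
    [exists Y; last by split=> //; exact: XY
    |exists X; last by split=> //; exact: YX].
have domS X x : F X -> sq_dom X x -> sq_dom (\bigcup_(X in F) X) x.
  by move=> FX [z Xz]; exists z, X.
split=> [x y z [X FX Xp]|x y [u [X FX Xu]] [v [Y FY Yv]]| |].
- by have [/(_ _ _ _ Xp)[? ? ?] _ _ _] := FP _ FX; split; apply: domS FX _.
- have [Z FZ [Zu Zv]] := common _ _ _ _ FX FY Xu Yv.
  have [_ Zt _ _] := FP _ FZ.
  have [z Zz] := Zt x y (ex_intro _ u Zu) (ex_intro _ v Zv).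
  by exists z, Z.
- move=> x y z z' [X FX Xp] [Y FY Yq].
  by have [Z /FP[_ _ Zf _] [Zp]] := common _ _ _ _ FX FY Xp Yq; exact: Zf.
- move=> x y x' y' z [X FX Xp] [Y FY Yq].
  by have [Z /FP[_ _ _ Zi] [Zp]] := common _ _ _ _ FX FY Xp Yq; exact: Zi.
Qed.

(** Hessenberg's theorem. Take a maximal injection of [A * A] into [A] with
    [A] infinite. If the complement of [A] had a copy [C] of [A], the pairs from
    [A `|` C] that are not in [A * A] could be coded in [A], hence in [C],
    against maximality. So the complement of [A] injects into [A], and [K] into
    [A * A], hence into [A]. *)
Lemma card_square (K : Type) : infinite_set [set: K] ->
  exists p : K * K -> K, injective p.
Proof.
move=> /infiniteP/card_leTP[e einj _].
pose G0 : set (K * K * K) :=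
  [set t | exists i j, t = (e i, e j, e (pickle (i, j)))].
have G0dom x : sq_dom G0 x <-> exists i, x = e i.
  split=> [[z [i [j [-> _ _]]]]|[i ->]]; first by exists i.
  by exists (e (pickle (i, i))), i, i.
have G0P : sq_embedding G0.
  split=> [x y z [i [j [-> -> ->]]]|x y /G0dom[i ->] /G0dom[j ->]| |].
  - by split; apply/G0dom; [exists i|exists j|exists (pickle (i, j))].
  - by exists (e (pickle (i, j))), i, j.
  - by move=> x y z z' [i [j [-> -> ->]]] [i' [j' [/einj<- /einj<- ->]]].
  - move=> x y x' y' z [i [j [-> -> ->]]] [i' [j' [-> -> /einj]]].
    by move=> /(pcan_inj pickleK)[-> ->].
have [||G [[Gdom Gtot Gf Gi] G0G Gmax]] := @Zorn_above _ (@sq_embedding K) G0.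
- by [].
- by move=> F FP _; exact: sq_embedding_bigcup.
set A := sq_dom G.
have Ae i : A (e i) by have [z] := (G0dom (e i)).2 (ex_intro _ i erefl);
  move=> /G0G Gz; exists z.
have /choice[f fG] (t : K * K) : exists z, A t.1 -> A t.2 -> G (t.1, t.2, z).
  have [[At1 At2]|nA] := pselect (A t.1 /\ A t.2).
    by have [z Gz] := Gtot _ _ At1 At2; exists z.
  by exists t.1 => At1 At2; exfalso; apply: nA.
have fA x y : A x -> A y -> A (f (x, y)).
  by move=> Ax Ay; have [] := Gdom _ _ _ (fG (x, y) Ax Ay).
have finj x y x' y' : A x -> A y -> A x' -> A y' -> f (x, y) = f (x', y') ->
    (x, y) = (x', y').
  move=> Ax Ay Ax' Ay' ff; apply: (Gi _ _ _ _ (f (x, y))).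
    exact: (fG (x, y)).
  by rewrite ff; exact: (fG (x', y')).
have [/(card_le_fun (e 0))[h hA hinj]|/(card_le_fun (e 0))[g gA ginj]] :=
    card_le_total A (~` A).
  have {}hinj x y : A x -> A y -> h x = h y -> x = y.
    by move=> Ax Ay; apply: hinj; rewrite inE.
  exfalso.
  (* [r] folds the copy [h @` A] back onto [A]. *)
  have /choice[r rP] x : exists y, (A x -> y = x) /\
      (forall a, A a -> x = h a -> y = a).
    have [Ax|nAx] := pselect (A x).
      by exists x; split=> // a /hA ha xh; case: ha; rewrite -xh.
    have [[a Aa ->]|nh] := pselect (exists2 a, A a & x = h a).
      exists a; split=> [/(hA _ Aa)//|b Ab hab]; exact: hinj.
    by exists x; split=> // a Aa xh; case: nh; exists a.
  have rh a : A a -> r (h a) = a by move=> Aa; exact: (rP (h a)).2.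
  have rA x : A x -> r x = x by exact: (rP x).1.
  pose B := A `|` h @` A.
  have rB x : B x -> A (r x).
    by move=> [Ax|[a Aa <-]]; [rewrite rA|rewrite rh].
  have rinj x y : B x -> B y -> `[< A x >] = `[< A y >] -> r x = r y -> x = y.
    move=> [Ax|[a Aa <-]] [Ay|[b Ab <-]].
    - by rewrite !rA.
    - by rewrite (asboolT Ax) (asboolF (hA _ Ab)).
    - by rewrite (asboolT Ay) (asboolF (hA _ Aa)).
    - by rewrite !rh// => _ ->.
  (* [r] identifies each point of [A] with its copy; the tag remembers which of
     the two was given, for both components. *)
  pose tag (x y : K) := e (`[< A x >] + `[< A y >].*2).
  pose code x y := f (tag x y, f (r x, r y)).
  have codeA x y : B x -> B y -> A (code x y).
    by move=> Bx By; apply: (fA); [exact: Ae|apply: fA; exact: rB].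
  have codeinj x y x' y' : B x -> B y -> B x' -> B y' ->
      code x y = code x' y' -> (x, y) = (x', y').
    move=> Bx By Bx' By' cc.
    have fr a b : B a -> B b -> A (f (r a, r b)).
      by move=> Ba Bb; apply: fA; exact: rB.
    have [/einj txy rxy] :=
      finj _ _ _ _ (Ae _) (fr _ _ Bx By) (Ae _) (fr _ _ Bx' By') cc.
    have [] := finj _ _ _ _ (rB _ Bx) (rB _ By) (rB _ Bx') (rB _ By') rxy.
    move: (rinj _ _ Bx Bx') (rinj _ _ By By') txy.
    by case: `[< A x >]; case: `[< A x' >]; case: `[< A y >]; case: `[< A y' >];
      move=> // /(_ erefl) rx /(_ erefl) ry _ /rx-> /ry->.
  pose N t := B t.1.1 /\ B t.1.2 /\ ~ (A t.1.1 /\ A t.1.2) /\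
              t.2 = h (code t.1.1 t.1.2).
  have GNdom : sq_dom (G `|` N) = B.
    apply/seteqP; split=> [x [z [Gz|[]//]]|x [Ax|[a Aa <-]]].
    - by left; exists z.
    - by exists (f (x, x)); left; exact: (fG (x, x)).
    - exists (h (code (h a) (h a))); right.
      have Bh : B (h a) by right; exists a.
      by do !split=> //; move=> [/(hA _ Aa)].
  have GA x y z : G (x, y, z) -> [/\ A x, A y & A z] by exact: Gdom.
  have NP x y z : N (x, y, z) -> [/\ B x, B y, ~ A z & exists2 a, A a & z = h a].
    move=> [/= Bx [By [_ ->]]]; split=> //.
      by apply: hA; exact: codeA.
    by exists (code x y) => //; exact: codeA.
  have GN : sq_embedding (G `|` N).
    rewrite /sq_embedding GNdom; split.
    - move=> x y z [/GA[? ? ?]|/NP[? ? _ [a Aa ->]]]; first by split; left.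
      by split=> //; right; exists a.
    - move=> x y Bx By; have [[Ax Ay]|nA] := pselect (A x /\ A y).
        by exists (f (x, y)); left; exact: (fG (x, y)).
      by exists (h (code x y)); right.
    - move=> x y z z' [Gz|Nz] [Gz'|Nz'].
      + exact: Gf Gz Gz'.
      + by have [Ax Ay _] := GA _ _ _ Gz; case: Nz' => [_ [_ [/= []]]].
      + by have [Ax Ay _] := GA _ _ _ Gz'; case: Nz => [_ [_ [/= []]]].
      + by case: Nz Nz' => [_ [_ [/= _ ->]]] [_ [_ [/= _ ->]]].
    - move=> x y x' y' z [Gz|Nz] [Gz'|Nz'].
      + exact: Gi Gz Gz'.
      + by have [_ _ Az] := GA _ _ _ Gz; case: (NP _ _ _ Nz').
      + by have [_ _ Az] := GA _ _ _ Gz'; case: (NP _ _ _ Nz).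
      + case: Nz Nz' => [/= Bx [By [_ ->]]] [/= Bx' [By' [_]]].
        by move=> /hinj/codeinj; apply=> //; exact: codeA.
  have Bh : B (h (e 0)) by right; exists (e 0).
  apply: (hA _ (Ae 0)).
  move: Bh; rewrite -GNdom => -[z GNz]; exists z.
  by apply: Gmax GNz => //; exact: subsetUl.
have {}ginj x y : ~ A x -> ~ A y -> g x = g y -> x = y.
  by move=> Ax Ay; apply: ginj; rewrite inE.
pose k x := f (e `[< A x >], if pselect (A x) then x else g x).
have kA x : A (k x).
  by apply: (fA); [exact: Ae|case: pselect => //; exact: gA].
have kinj : injective k.
  have kA' x : A (if pselect (A x) then x else g x).
    by case: pselect => //; exact: gA.
  move=> x y /(finj _ _ _ _ (Ae _) (kA' x) (Ae _) (kA' y))[].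
  move=> /einj; case: pselect => [Ax|nAx]; case: pselect => [Ay|nAy] //=.
  - by rewrite (asboolT Ax) (asboolF nAy).
  - by rewrite (asboolT Ay) (asboolF nAx).
  - by move=> _; exact: ginj.
exists (fun t => f (k t.1, k t.2)) => -[x y] [x' y'] /=.
by move=> /(finj _ _ _ _ (kA x) (kA y) (kA x') (kA y'))[/kinj-> /kinj->].
Qed.

(** Code a sequence by its size and the iterated pairing of its entries: the
    size makes the iterated pairing decodable. *)
Lemma seq_injection (K : Type) : infinite_set [set: K] ->
  exists p : seq K -> K, injective p.
Proof.
move=> Kinf; have [p pinj] := card_square Kinf.
move: Kinf => /infiniteP/card_leTP[e einj _].
pose fold := foldr (fun x y => p (x, y)) (e 0).
exists (fun s => p (e (size s), fold s)) => s t /pinj[/einj].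
elim: s t => [|x s IHs] [|y t] //= [st] /pinj[-> /IHs->//].
Qed.

(** * Ideals of sets and the independent family *)

Definition set_ideal (S : Type) (J : set (set S)) : Prop :=
  [/\ J set0, forall A B, B `<=` A -> J A -> J B &
      forall A B, J A -> J B -> J (A `|` B)].

(** For unions: if [K], viewed as [K * K], embeds into the union of [A] and
    [B], then either some row lies in [A], or each row has a point in [B]; both
    give a copy of [K]. *)
Lemma small_sets_ideal (K S : Type) : infinite_set [set: K] ->
  set_ideal [set A : set S | ~ ([set: K] #<= A)].
Proof.
move=> Kinf; split=> /= [|A B BA nA /card_leTP[f finj fB]|A B nA nB].
- move=> /card_leTP[f _ f0]; apply: Kinf.
  by have -> : [set: K] = set0 by rewrite -subset0 => x _; exact: (f0 x).
- by apply/nA/card_leTP; exists f => // x; exact/BA/fB.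
- have [p pinj] := card_square Kinf.
  move=> /card_leTP[f finj fAB].
  have [[a ha]|na] := pselect (exists a, forall b, A (f (p (a, b)))).
    apply/nA/card_leTP; exists (fun b => f (p (a, b))) => //.
    by move=> b b' /finj/pinj[].
  have /choice[c cP] a : exists b, ~ A (f (p (a, b))).
    by apply/existsNP => ha; apply: na; exists a.
  apply/nB/card_leTP; exists (fun a => f (p (a, c a))).
    by move=> a a' /finj/pinj[].
  by move=> a; have [/(cP a)|] := fAB (p (a, c a)).
Qed.

Lemma infinite_not_le_set1 (K S : Type) (s : S) : infinite_set [set: K] ->
  ~ ([set: K] #<= [set s]).
Proof. by move=> Kinf /card_le_finite; move/(_ (finite_set1 s)). Qed.

(** If [N] is not in the maximal ideal [J], the ideal of the sets [B] with
    [B `\` N] in [J] is strictly larger, so it meets [P]. *)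
Lemma maximal_ideal (S : Type) (P J0 : set (set S)) :
    set_ideal J0 -> (forall A, P A -> ~ J0 A) ->
  exists J, [/\ set_ideal J, J0 `<=` J, forall A, P A -> ~ J A &
    forall N, ~ J N -> exists2 A, P A & J (A `\` N)].
Proof.
move=> J0I J0P.
pose good J := set_ideal J /\ forall A, P A -> ~ J A.
have [||J [[JI JP] J0J Jmax]] := @Zorn_above _ good J0; first by split.
  move=> F Fgood [J1 FJ1] Ftot; split; last first.
    by move=> A PA [J FJ JA]; have [_ /(_ _ PA)] := Fgood _ FJ.
  split.
  - by exists J1 => //; have [[]] := Fgood _ FJ1.
  - move=> A B BA [J FJ JA]; exists J => //.
    by have [[_ /(_ _ _ BA)]] := Fgood _ FJ; auto.
  - move=> A B [J FJ JA] [J' FJ' JB].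
    have [JJ'|J'J] := Ftot _ _ FJ FJ'.
      by exists J' => //; have [[_ _ JU] _] := Fgood _ FJ'; apply: JU => //; exact: JJ'.
    by exists J => //; have [[_ _ JU] _] := Fgood _ FJ; apply: JU => //; exact: J'J.
exists J; split=> // N nJN; have [Jn JS JU] := JI.
apply: contrapT => nA.
pose J' : set (set S) := [set B | J (B `\` N)].
apply: nJN; apply: (Jmax J').
- by move=> B JB; apply: JS JB; exact: subDsetl.
- split; last by move=> A PA J'A; apply: nA; exists A.
  split=> /=.
  + by rewrite /J' /= set0D.
  + by move=> A B BA; apply: JS; exact: setSD.
  + by move=> A B JA JB; rewrite /J' /= setDUl; exact: JU.
- by rewrite /J' /= setDv.
Qed.

(** The Fichtenholz-Kantorovich-Hausdorff family: a point is a finite list [l]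
    of elements of [K] with a list [L] of patterns, and it is in the set indexed
    by [X] when the trace of [X] on [l] is one of the patterns. Given finitely
    many sets, choose [l] such that it tells them apart, and list the traces of
    those whose value should be [true]. The additional factor [K] repeats each
    point [#|K|] times. *)
Lemma independent_family (K : Type) : infinite_set [set: K] ->
  exists (S : Type) (x : S -> set K -> bool),
    [set: S] #<= [set: K] /\
    forall (F : seq (set K)) (y : set K -> bool),
      [set: K] #<= [set s | forall X, X \in F -> x s X = y X].
Proof.
move=> Kinf.
have [p pinj] := card_square Kinf; have [q qinj] := seq_injection Kinf.
have /infiniteP/card_leTP[e einj _] := Kinf.
pose S := (K * seq K * seq (seq bool))%type.
pose pat (l : seq {classic K}) (X : set K) := [seq `[< X k >] | k : {classic K} <- l].
exists S, (fun s X => pat s.1.2 X \in s.2); split.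
  apply/card_leTP; exists (fun s => p (p (s.1.1, q s.1.2), e (pickle s.2))) => //.
  by move=> [[a b] c] [[a' b'] c'] /pinj[/pinj[/= <- /qinj<-] /einj/(pcan_inj pickleK)<-].
move=> F y.
have /choice[d dP] (XY : set K * set K) :
    exists k, (XY.1 k <-> XY.2 k) -> XY.1 = XY.2.
  have [->|/eqP neqXY] := eqVneq XY.1 XY.2; first by exists (e 0).
  apply: contrapT => /forallNP nd; apply: neqXY; apply/seteqP.
  by split=> k; have /not_implyP[[]] := nd k.
pose l : seq {classic K} := [seq d (X, Y) | X <- F, Y <- F].
have patinj X Y : X \in F -> Y \in F -> pat l X = pat l Y -> X = Y.
  move=> XF YF; rewrite /pat => /eq_in_map XY.
  apply: (dP (X, Y)) => /=.
  have dF : (d (X, Y) : {classic K}) \in l.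
    by apply/allpairsP; exists (X, Y).
  by have XYd := XY _ dF; split=> Z; apply/asboolP;
    [rewrite -XYd|rewrite XYd]; exact/asboolP.
pose L := [seq pat l X | X <- F & y X].
apply/card_leTP; exists (fun k => (k, l, L)); first by move=> k k' [].
move=> k X XF /=; apply/mapP; case yX: (y X).
  by exists X => //; rewrite mem_filter yX.
by move=> [Y]; rewrite mem_filter => /andP[yY YF] /(patinj _ _ XF YF) XY;
  rewrite -XY yX in yY.
Qed.

(** * Making the ideal closed *)

Definition cylinder (K : Type) (F : seq (set K)) (y : cantor_cube K) :
    set (cantor_cube K) :=
  [set z | forall X, X \in F -> z X = y X].

(** The combinatorial content of the space sought. The points [pt s i], [s] in
    [S], form the piece of index [i]. The clauses say that each piece is dense
    modulo [J], that sets with all slices in [J] are closed, and that in each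
    piece the sets outside [J] contain a trace of a cylinder modulo [J]. *)
Definition submaximal_coloring (K S I : Type) (J : set (set S))
    (pt : S -> I -> cantor_cube K) : Prop :=
  [/\ forall i F y, ~ J [set s | cylinder F y (pt s i)],
      forall N : I -> set S, (forall i, J (N i)) ->
        forall s i, ~ N i s -> exists X, pt s i X = true /\
          forall j t, N j t -> pt t j X = false &
      forall N i, ~ J N -> exists F y,
        J [set s | cylinder F y (pt s i) /\ ~ N s]].

(** A coordinate [X] is decoded as two sets: [N false X], with slices meant to
    be in [J], and [N true X], meant to be a single point outside it. If their
    union [M X] has all its slices in [J], the coordinate is overwritten on
    [M X] to take the value [true] exactly on [N true X]. A finite set of
    coordinates is thereby changed on a member of [J] only, and this transfers
    the properties of [J] from the independent family to [pt]. *)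
Lemma exists_submaximal_coloring (K : Type) (n : nat) :
    infinite_set [set: K] ->
  exists (S : Type) (J : set (set S)) (pt : S -> 'I_n -> cantor_cube K),
    [/\ [set: S * 'I_n] #<= [set: K], set_ideal J,
        forall A, ~ ([set: K] #<= A) -> J A & submaximal_coloring J pt].
Proof.
move=> Kinf; have [S [x [SK xind]]] := independent_family Kinf.
pose base (A : set S) := exists F y, A = [set s | cylinder F y (x s)].
have [A [F [y ->]] /(_ (xind F y))//|J [JI smallJ Jbase Jmax]] :=
  @maximal_ideal S base _ (small_sets_ideal S Kinf).
have [J0 JS JU] := JI.
have [p pinj] := card_square Kinf.
have /infiniteP/card_leTP[e einj _] := Kinf.
have [r rinj] : exists r : S * 'I_n -> K, injective r.
  have /card_leTP[q qinj _] := SK.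
  exists (fun t : S * 'I_n => p (q t.1, e t.2)).
  by move=> [s i] [s' i'] /pinj[/= /qinj<- /einj/val_inj<-].
have [g ginj] : exists g : S * 'I_n * bool -> K, injective g.
  exists (fun t : S * 'I_n * bool => p (r t.1, e t.2)).
  move=> [t b] [t' b'] /pinj[/= /rinj<- /einj bb'].
  by congr (_, _); case: b b' bb' => -[].
pose N (b : bool) (X : set K) i := [set s | X (g (s, i, b))].
pose M X i := N false X i `|` N true X i.
pose pt s i X : bool :=
  if `[< (forall j, J (M X j)) /\ M X i s >] then `[< N true X i s >] else x s X.
have pt_base (F : seq (set K)) i :
    exists2 E, J E & forall s X, ~ E s -> X \in F -> pt s i X = x s X.
  elim: F => [|X F [E JE FE]]; first by exists set0.
  have [XJ|nXJ] := pselect (forall j, J (M X j)).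
    exists (E `|` M X i); first exact: JU.
    move=> s Y /not_orP[nE nM]; rewrite inE => /orP[/eqP->|]; last exact: FE.
    by rewrite /pt asboolF// => -[].
  exists E => // s Y nE; rewrite inE => /orP[/eqP->|]; last exact: FE.
  by rewrite /pt asboolF// => -[].
exists S, J, pt; split=> //; first by apply/card_leTP; exists r.
split.
- move=> i F y JF; apply: (Jbase [set s | cylinder F y (x s)]).
    by exists F, y.
  have [E JE FE] := pt_base F i.
  apply: (JS _ _ _ (JU _ _ JF JE)) => s sF.
  have [Es|nEs] := pselect (E s); first by right.
  by left=> X XF; rewrite FE// sF.
- move=> N' JN' s i nNs.
  pose X : set K := [set k | exists t j b, k = g (t, j, b) /\
    if b then t = s /\ j = i else N' j t].
  have NT j : N true X j = [set t | t = s /\ j = i].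
    apply/seteqP; split=> t; last by exists t, j, true.
    by move=> [t' [j' [b [/ginj[<- <- <-]]]]].
  have NF j : N false X j = N' j.
    apply/seteqP; split=> t; last by exists t, j, false.
    by move=> [t' [j' [b [/ginj[<- <- <-]]]]].
  have JX j : J (M X j).
    apply: JU; rewrite ?NF ?NT//; apply: (JS [set s]); first by move=> t [].
    by apply: smallJ; exact: infinite_not_le_set1.
  exists X; split.
    by rewrite /pt asboolT /= ?NT ?asboolT//; split=> //; right; rewrite NT.
  move=> j t Nt; rewrite /pt asboolT; last by split=> //; left; rewrite NF.
  by apply: asboolF; rewrite NT => -[ts ji]; apply: nNs; rewrite -ts -ji.
- move=> A i nJA; have [_ [F [y ->]] JFA] := Jmax _ nJA.
  exists F, y; have [E JE FE] := pt_base F i.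
  apply: (JS _ _ _ (JU _ _ JFA JE)) => s [sF nAs].
  have [Es|nEs] := pselect (E s); first by right.
  by left; split=> // X XF; rewrite -FE// sF.
Qed.

(** * Subspaces, and unions of submaximal subspaces *)

Lemma open_subtypeP (T : topologicalType) (A : set T) (U : set A) :
  open U <-> exists2 V : set T, open V & U = [set a | V (val a)].
Proof. by split=> -[V oV VU]; exists V => //; rewrite -?VU// VU. Qed.

(** If [E] contains the trace on [D] of no nonempty open subset of [V], then
    removing [E `&` V] from [D] leaves a dense set, open in [D] by
    submaximality, say the trace of [O]; then [O `&` V] misses [E]. *)
Lemma submaximal_dichotomy (T : topologicalType) (D E V : set T) :
    dense D -> submaximal D -> open V -> V !=set0 -> E `<=` D ->
  exists W, [/\ open W, W !=set0, W `<=` V & W `&` D `<=` E \/ W `&` E = set0].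
Proof.
move=> Dd Dsub oV V0 ED.
have [[W [oW W0 WV WE]]|noW] :=
    pselect (exists W, [/\ open W, W !=set0, W `<=` V & W `&` D `<=` E]).
  by exists W; split=> //; left.
have D'd W : open W -> W !=set0 -> exists2 d, W d /\ D d & ~ (E d /\ V d).
  move=> oW W0; apply: contrapT => nd.
  have WD d : W d -> D d -> E d /\ V d.
    by move=> Wd Dd'; apply: contrapT => nEV; apply: nd; exists d.
  apply: noW; exists (W `&` V); split.
  - exact: openI.
  - by have [d [Wd Dd']] := Dd _ W0 oW; exists d; split=> //; case: (WD d).
  - by move=> d [].
  - by move=> d [[Wd _] Dd']; case: (WD d).
have [|O oO OE] := (@open_subtypeP _ D [set d | ~ (E (val d) /\ V (val d))]).1.
  apply: Dsub => P [p Pp] /open_subtypeP[W oW PW].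
  have [|d [Wd Dd'] nd] := D'd W oW; first by exists (val p); rewrite PW in Pp.
  by exists (SigSub (mem_set Dd')); split=> //; rewrite PW.
exists (O `&` V); split.
- exact: openI.
- have [v [Vv Dv] nv] := D'd V oV V0; exists v; split=> //.
  have : [set d : D | ~ (E (val d) /\ V (val d))] (SigSub (mem_set Dv)) by [].
  by rewrite OE.
- by move=> d [].
- right; rewrite -subset0 => d [[Od Vd] Ed].
  have : [set d : D | O (val d)] (SigSub (mem_set (ED _ Ed))) by [].
  by rewrite -OE /=; apply.
Qed.

(** Apply the dichotomy to [E `&` D i] for each [i] in turn. The second
    alternative cannot hold for all of them, for [E] is dense in [V]. *)
Lemma exists_open_in_piece (T : topologicalType) (n : nat) (D : 'I_n -> set T)
    (E V : set T) :
    \bigcup_i D i = [set: T] -> (forall i, dense (D i)) ->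
    (forall i, submaximal (D i)) -> open V -> V !=set0 ->
    (forall W, open W -> W !=set0 -> W `<=` V -> W `&` E !=set0) ->
  exists W i, [/\ open W, W !=set0, W `<=` V & W `&` D i `<=` E].
Proof.
move=> DT Dd Dsub oV V0 Ed; apply: contrapT => noW.
have [W [oW W0 WV WE]] : exists W, [/\ open W, W !=set0, W `<=` V &
    forall i, i \in enum 'I_n -> W `&` (E `&` D i) = set0].
  elim: (enum 'I_n) => [|i l [W [oW W0 WV WE]]]; first by exists V; split.
  have [W' [oW' W'0 W'W [W'E|W'E]]] :=
    @submaximal_dichotomy _ (D i) (E `&` D i) W (Dd i) (Dsub i) oW W0 (@subIsetr _ _ _).
    exfalso; apply: noW; exists W', i; split=> //.
      exact: subset_trans WV.
    by move=> d /W'E[].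
  exists W'; split=> //; first exact: subset_trans WV.
  move=> j; rewrite inE => /orP[/eqP->//|jl].
  by rewrite -subset0 -(WE j jl); exact: setSI.
have [w [Ww Ew]] := Ed W oW W0 WV.
have [i _ Di] : (\bigcup_i D i) w by rewrite DT.
have : (W `&` (E `&` D i)) w by [].
by rewrite WE// mem_enum.
Qed.

Lemma union_submaximal_not_resolvable (T : topologicalType) (n : nat) :
    (0 < n)%N -> nodec T -> disjoint_union_dense_submaximal n T ->
  forall Z : set T, Z !=set0 -> ~ resolvable 'I_n.+1 Z.
Proof.
move=> n0 Tnodec [D [_ DT Dd Dsub]] Z [z Zz] [E [Ed Etriv]].
have Edisj j j' x : E j x -> E j' x -> j = j'.
  by move=> Ex Ex'; apply: Etriv => //; exists x.
have [Znwd|/set0P U0] := eqVneq (interior (closure Z)) set0.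
  (* All subsets of [Z] are nowhere dense, hence closed, and [Z] is discrete:
     every dense subset contains [z]. *)
  have closedZ A : A `<=` Z -> closed A.
    move=> AZ; apply: Tnodec; rewrite /nowhere_dense -subset0 -Znwd.
    by apply: interiorS; exact: closureS.
  have openZ (A : set Z) : open A.
    apply/open_subtypeP; exists (~` [set val a | a in ~` A]).
      apply: closed_openC; apply: closedZ => _ [a _ <-]; exact: set_valP.
    apply/seteqP; split=> [a Aa [b nAb /val_inj ba]|a /=].
      by apply: nAb; rewrite ba.
    by move=> nA; apply: contrapT => nAa; apply: nA; exists a.
  have Ez j : E j (SigSub (mem_set Zz)).
    by have [||x [-> //]] := Ed j [set SigSub (mem_set Zz)]; [exists (SigSub (mem_set Zz))|exact: openZ].
  have := Edisj _ _ _ (Ez ord0) (Ez ord_max).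
  by move=> /(congr1 val)/= n0'; rewrite -n0' in n0.
set U := interior (closure Z) in U0.
have EW j W : open W -> W !=set0 -> W `<=` U ->
    W `&` [set val x | x in E j] !=set0.
  move=> oW [w Ww] WU; have clw := interior_subset (WU _ Ww).
  have [y [Zy Wy]] := clw W (open_nbhs_nbhs (conj oW Ww)).
  have [||x [Wx Ex]] := Ed j [set x : Z | W (val x)].
  - by exists (SigSub (mem_set Zy)).
  - by apply/open_subtypeP; exists W.
  - by exists (val x); split=> //; exists x.
(* Shrink [U] once for each [E j]. *)
have [W [oW W0 WE]] : exists W, [/\ open W, W !=set0 &
    forall j, j \in enum 'I_n.+1 -> exists i, W `&` D i `<=` [set val x | x in E j]].
  suff [W [oW W0 _ WE]] : exists W, [/\ open W, W !=set0, W `<=` U &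
    forall j, j \in enum 'I_n.+1 -> exists i, W `&` D i `<=` [set val x | x in E j]].
    by exists W.
  elim: (enum 'I_n.+1) => [|j l [W [oW W0 WU WE]]].
    by exists U; split=> //; exact: open_interior.
  have [|W' [i [oW' W'0 W'W W'E]]] := @exists_open_in_piece _ _ D
    [set val x | x in E j] W DT Dd Dsub oW W0.
    by move=> V oV V0 VW; apply: EW => //; exact: subset_trans WU.
  exists W'; split=> //; first exact: subset_trans WU.
  move=> k; rewrite inE => /orP[/eqP->|/WE[i' Wi']]; first by exists i.
  by exists i' => d [W'd Dd']; apply: Wi'; split=> //; exact: W'W.
have /choice[f fE] j : exists i, W `&` D i `<=` [set val x | x in E j].
  by apply: WE; rewrite mem_enum.
have /injectivePn[j [j' jj' ff']] : ~~ injectiveb f.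
  by apply/negP => /injectiveP/leq_card; rewrite !card_ord ltnn.
have [w [Ww Dw]] := Dd (f j) W W0 oW.
have [x Ex xw] := fE j w (conj Ww Dw).
rewrite ff' in Dw; have [x' Ex' x'w] := fE j' w (conj Ww Dw).
have xx' : x = x' by apply: val_inj; rewrite xw x'w.
by rewrite -xx' in Ex'; rewrite (Edisj _ _ _ Ex Ex') eqxx in jj'.
Qed.

(** * The space defined by a coloring *)

Lemma cylinder_open (K : Type) (F : seq (set K)) (y : cantor_cube K) :
  open (cylinder F y).
Proof.
elim: F => [|X F oF].
  by have -> : cylinder [::] y = setT by [exact/seteqP]; exact: openT.
have -> : cylinder (X :: F) y = [set z | z X = y X] `&` cylinder F y.
  apply/seteqP; split=> z.
    move=> zF; split=> [|Y YF]; apply: zF; rewrite inE ?eqxx//.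
    by rewrite YF orbT.
  by move=> [zX zF] Y; rewrite inE => /orP[/eqP->|/zF].
apply: openI => //.
have /continuousP : continuous (fun z : cantor_cube K => z X).
  exact: (@proj_continuous _ (fun _ : set K => bool) X).
by move=> /(_ [set y X] (discrete_open _)).
Qed.

(** The sets containing some [cylinder F y] form a filter, and it converges to
    [y] because it does so in each coordinate. *)
Lemma cylinder_basis (K : Type) (O : set (cantor_cube K)) (y : cantor_cube K) :
  open O -> O y -> exists F, cylinder F y `<=` O.
Proof.
move=> oO Oy.
pose G : set_system (cantor_cube K) :=
  [set A | exists F, cylinder F y `<=` A].
have GF : Filter G.
  split=> [|A B [F FA] [F' FB]|A B AB [F FA]].
  - by exists [::].
  - exists (F ++ F') => z zF; split.
      by apply: FA => X XF; apply: zF; rewrite mem_cat XF.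
    by apply: FB => X XF; apply: zF; rewrite mem_cat XF orbT.
  - by exists F; exact: subset_trans AB.
suff : G --> y by apply; exact: open_nbhs_nbhs.
apply/cvg_sup => X A [_ [[V oV <-] Vy VA]].
exists [:: X] => z zX; apply: VA => /=.
by rewrite zX// inE.
Qed.

(** Three facts carry the proof: nonempty open sets have no slice in [J]
    ([open_big]), sets with all slices in [J] are closed ([closedJ]), and a set
    whose slice of index [i] is not in [J] contains, within the piece of index
    [i], a nonempty open set ([open_inside]). *)
Lemma submaximal_coloring_space (K S I : Type) (i0 : I) (J : set (set S))
    (pt : S -> I -> cantor_cube K) :
    infinite_set [set: K] -> [set: S * I] #<= [set: K] -> set_ideal J ->
    (forall A, ~ ([set: K] #<= A) -> J A) -> submaximal_coloring J pt ->
  exists Y : set (cantor_cube K), C_space Y /\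
    exists D : I -> set Y,
      [/\ trivIset [set: I] D, \bigcup_i D i = [set: Y],
          forall i, dense (D i) & forall i, submaximal (D i)].
Proof.
move=> Kinf SIK [J0 JS JU] smallJ [Jcyl Jsep Jmax].
have J1 s : J [set s] by apply: smallJ; exact: infinite_not_le_set1.
have ptinj s i t j : pt s i = pt t j -> (s, i) = (t, j).
  move=> st; apply: contrapT => nst.
  have [||X [sX tX]] := Jsep (fun k => [set u | u = t /\ k = j]) _ s i.
  - by move=> k; apply: JS (J1 t) => u [].
  - by move=> [si ij]; apply: nst; rewrite si ij.
  - by have := tX j t (conj erefl erefl); rewrite -st sX.
pose Y : set (cantor_cube K) := [set z | exists s i, pt s i = z].
have Ypt s i : pt s i \in Y by apply/mem_set; exists s, i.
pose y s i : Y := SigSub (Ypt s i).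
have yP (z : Y) : exists s i, z = y s i.
  by have [s [i st]] := set_valP z; exists s, i; apply: val_inj; rewrite /= -st.
have yinj s i t j : y s i = y t j -> (s, i) = (t, j).
  by move=> /(congr1 val)/ptinj.
pose slice (A : set Y) i := [set s | A (y s i)].
have open_big (U : set Y) i : open U -> U !=set0 -> ~ J (slice U i).
  move=> /open_subtypeP[V oV UV] [z Uz].
  have Vz : V (val z) by rewrite UV in Uz.
  have [F FV] := cylinder_basis oV Vz.
  move=> JU'; apply: (Jcyl i F (val z)); apply: JS JU' => s sF.
  by rewrite /slice /= UV /=; exact: FV.
have open_meet (U : set Y) i : open U -> U !=set0 -> exists s, U (y s i).
  move=> oU U0; apply: contrapT => nU; apply: (open_big U i oU U0).
  by apply: JS J0 => s Us; apply: nU; exists s.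
have closedJ (A : set Y) : (forall i, J (slice A i)) -> closed A.
  move=> JA; rewrite -openC openE => z nAz.
  have [s [i zE]] := yP z; rewrite zE in nAz *.
  have [X [sX AX]] := Jsep _ JA s i nAz.
  rewrite /interior nbhsE.
  exists [set z : Y | cylinder [:: X] (pt s i) (val z)].
    split; last by [].
    by apply/open_subtypeP; exists (cylinder [:: X] (pt s i)) => //; exact: cylinder_open.
  move=> w wX Aw; have [t [j wE]] := yP w; rewrite wE in wX Aw.
  have := wX X; rewrite inE eqxx => /(_ isT).
  by rewrite sX /= (AX _ _ Aw).
have open_inside (A : set Y) i : ~ J (slice A i) ->
    exists U, [/\ open U, U !=set0 & forall s, U (y s i) -> A (y s i)].
  move=> nJA; have [F [z JF]] := Jmax _ i nJA.
  (* [E] is the part of the cylinder in the piece [i] that lies outside [A]; it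
     is closed and can be cut off. *)
  pose E : set Y := [set w | exists s, w = y s i /\
    (cylinder F z (pt s i) /\ ~ A (y s i))].
  have oE : open (~` E).
    apply: closed_openC; apply: closedJ => j; apply: JS JF => s [t [+ tF]].
    by move=> /yinj[->].
  pose C : set Y := [set w | cylinder F z (val w)].
  have oC : open C.
    by apply/open_subtypeP; exists (cylinder F z) => //; exact: cylinder_open.
  exists (C `&` ~` E); split.
  - exact: openI.
  - apply: contrapT => nCE; apply: (Jcyl i F z); apply: JS JF => s sF.
    split=> // As; apply: nCE; exists (y s i); split=> // -[t [/yinj[<-]]].
    by move=> [_].
  - move=> s [sC sE]; apply: contrapT => nA; apply: sE; exists s.
    by split.
have card_slice (A : set Y) i : ~ J (slice A i) -> [set: K] #<= A.
  move=> nJA; apply: contrapT => KA; apply: nJA; apply: smallJ.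
  move=> /card_leTP[f finj fA]; apply/KA/card_leTP.
  by exists (fun k => y (f k) i) => [k k' /yinj[/finj]|k]; last exact: fA.
have YT0 : [set: Y] !=set0.
  have /infiniteP/card_leTP[e _ _] := Kinf.
  apply: contrapT => nY; apply: (Jcyl i0 [::] (fun _ => true)).
  by apply: JS J0 => s _; apply: nY; exists (y s i0).
have nwdT : ~ nowhere_dense [set: Y].
  by rewrite /nowhere_dense closureT interiorT; apply/eqP/set0P.
have YK : [set: Y] #= [set: K].
  apply/card_eqPle; split; last first.
    apply: (card_slice _ i0); apply: open_big => //; exact: openT.
  apply: card_le_trans SIK.
  apply: (@card_le_graph _ _ _ _ (fun z t => z = y t.1 t.2)) => [z _|].
    by have [s [i zE]] := yP z; exists (s, i).
  by move=> z z' t _ _ -> ->.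
exists Y; split.
  split=> //.
  - move=> O [z Oz] oO; have [F FO] := cylinder_basis oO Oz.
    apply: contrapT => nO; apply: (Jcyl i0 F z); apply: JS J0 => s sF.
    by apply: nO; exists (pt s i0); split; [exact: FO|exists s, i0].
  - move=> A Anwd; apply: closedJ => i; apply: contrapT => /open_inside.
    move=> [U [oU U0 UA]]; have [u Uu] := U0.
    suff /(_ u Uu) : U `<=` interior (closure A) by rewrite Anwd.
    rewrite -open_subsetE// => v Uv W; rewrite nbhsE => -[W' [oW' W'v] W'W].
    have [|s [Us W's]] := open_meet (U `&` W') i (openI oU oW').
      by exists v.
    by exists (y s i); split; [exact: UA|exact: W'W].
  - split; first by exists setT.
    move=> A; apply: contra_notP => KA; rewrite /nowhere_dense.
    have JA i : J (slice A i) by apply: contrapT => /card_slice.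
    have /closure_id <- := closedJ A JA.
    apply: contrapT => /eqP/set0P A0.
    apply: (open_big _ i0 (@open_interior _ A) A0).
    by apply: JS (JA i0) => s; exact: interior_subset.
  - split; first by exists setT => //; split=> //; exact: openT.
    by move=> U [oU U0]; apply: (card_slice _ i0); exact: open_big.
exists (fun i => [set y s i | s in [set: S]]); split.
- by move=> i j _ _ [_ [[s _ <-] [t _ /yinj[]]]].
- apply/seteqP; split=> // z _; have [s [i ->]] := yP z.
  by exists i => //; exists s.
- by move=> i U U0 oU; have [s Us] := open_meet U i oU U0; exists (y s i); split=> //; exists s.
- move=> i E Edense.
  (* If the complement of [E] had its slice outside [J], it would contain a
     nonempty open set, which the dense set [E] meets. *)
  pose A : set Y := [set val d | d in ~` E].
  have [JA|nJA] := pselect (J (slice A i)).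
    apply/open_subtypeP; exists (~` A).
      apply: closed_openC; apply: closedJ => j; apply: JS JA => s [d nEd dE].
      have [t _ td] := set_valP d.
      have [ts ij] := yinj _ _ _ _ (etrans td dE).
      by exists d => //; rewrite dE ij.
    apply/seteqP; split=> [d Ed [d' nEd' /val_inj dd']|d /= nAd].
      by apply: nEd'; rewrite dd'.
    by apply: contrapT => nEd; apply: nAd; exists d.
  have [U [oU U0 UA]] := open_inside A i nJA.
  have [s Us] := open_meet U i oU U0.
  have Ds : [set y s i | s in [set: S]] (y s i) by exists s.
  have [||d [Ud Ed]] := Edense [set d | U (val d)].
  - by exists (SigSub (mem_set Ds)).
  - by apply/open_subtypeP; exists U.
  - have [t _ td] := set_valP d.
    move: Ud => /=; rewrite -td => /UA[d' nEd' d'E].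
    by exfalso; apply: nEd'; have -> : d' = d by apply: val_inj; rewrite d'E.
Qed.

Unset Implicit Arguments.

Theorem corollary4p6 (K : Type) (n : nat) (hK : infinite_set [set: K])
    (hn : (1 <= n)%N) :
  (exists Y : set (cantor_cube K),
     C_space Y /\ disjoint_union_dense_submaximal n Y) /\
  (forall Y : set (cantor_cube K),
     C_space Y -> disjoint_union_dense_submaximal n Y ->
     forall Z : set Y, Z !=set0 -> ~ resolvable 'I_n.+1 Z).
Proof.
split=> [|Y [_ Ynodec _ _ _]].
  have [S [J [pt [SnK JI smallJ Jpt]]]] := exists_submaximal_coloring n hK.
  exact: (submaximal_coloring_space (Ordinal hn) hK SnK JI smallJ Jpt).
exact: union_submaximal_not_resolvable.
Qed.
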